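(* Let $\delta\in(0,n]$ and let $f\in L^1_{\rm loc}(\mathbb R^n,\widetilde{\mathcal H}_\infty^\delta)$ be real-valued. Then, for any cube $Q$ of $\mathbb R^n$, $$e^{f_{Q,\delta}}\le\frac1{\widetilde{\mathcal H}_\infty^\delta(Q)}\left\{\int_{Q\cap E_{f,+}}e^{f(x)}\,d\widetilde{\mathcal H}_\infty^\delta+\int_{Q\cap E_{f,-}}e^{f(x)}\,d\widetilde{\mathcal H}_\infty^\delta\right\}$$ and $$e^{-f_{Q,\delta}}\le\frac1{\widetilde{\mathcal H}_\infty^\delta(Q)}\left\{\int_{Q\cap E_{f,+}}e^{-f(x)}\,d\widetilde{\mathcal H}_\infty^\delta+\int_{Q\cap E_{f,-}}e^{-f(x)}\,d\widetilde{\mathcal H}_\infty^\delta\right\}.$$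
   Context: A cube $Q\subset\mathbb R^n$ is always left-open and right-closed with sides parallel to the coordinate axes; $l(Q)$ is its edge length. For $\delta\in(0,n]$ and $E\subset\mathbb R^n$ the dyadic Hausdorff content is $\widetilde{\mathcal H}_\infty^\delta(E)=\inf\{\sum_i l(Q_i)^\delta: E\subset(\bigcup_iQ_i)^\circ\}$, the infimum over families of dyadic cubes of $\mathbb R^n$, $G^\circ$ denoting the interior of $G$. For any (not necessarily measurable) $f\ge0$, the Choquet integral is $\int_E f\,d\widetilde{\mathcal H}_\infty^\delta=\int_0^\infty\widetilde{\mathcal H}_\infty^\delta(\{x\in E:f(x)>t\})\,dt$. $L^1_{\rm loc}(\mathbb R^n,\widetilde{\mathcal H}_\infty^\delta)$ is the set of functions with $\int_K|f|\,d\widetilde{\mathcal H}_\infty^\delta<\infty$ for every compact $K$. $E_{f,+}=\{x\in\mathbb R^n:f(x)\ge0\}$, $E_{f,-}=\{x\in\mathbb R^n:f(x)<0\}$, and $$f_{Q,\delta}=\frac{\int_{Q\cap E_{f,+}}f(x)\,d\widetilde{\mathcal H}_\infty^\delta-\int_{Q\cap E_{f,-}}[-f(x)]\,d\widetilde{\mathcal H}_\infty^\delta}{\widetilde{\mathcal H}_\infty^\delta(Q\cap E_{f,+})+\widetilde{\mathcal H}_\infty^\delta(Q\cap E_{f,-})}.$$ *)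

(* Defs.v *)
From HB Require Import structures.
From mathcomp Require Import all_boot all_order all_algebra.
From mathcomp Require Import all_classical all_reals all_analysis.

Set Implicit Arguments.
Unset Strict Implicit.
Unset Printing Implicit Defensive.

Import Order.TTheory GRing.Theory Num.Theory.
Import numFieldNormedType.Exports.

Local Open Scope classical_set_scope.
Local Open Scope ring_scope.

Definition cube (R : realType) (n : nat) (a : 'rV[R]_n) (l : R)
  : set 'rV[R]_n :=
  [set x | forall i, a 0 i < x 0 i <= a 0 i + l].

Definition is_cube (R : realType) (n : nat) (Q : set 'rV[R]_n) : Prop :=
  exists (a : 'rV[R]_n) (l : R), 0 < l /\ Q = cube a l.

(* [(k, m)] indexes the dyadic cube 2^-k (m + (0,1]^n).  For n >= 1 the index
   is determined by the cube, so a set of indices is a family of dyadic cubes;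
   such a family is at most countable. *)
Notation dyadic_index n := (int * 'rV[int]_n)%type.

Definition dyadic_length (R : realType) (n : nat) (j : dyadic_index n) : R :=
  2%:R ^ (- j.1).
Arguments dyadic_length R {n} j.

Definition dyadic_cube (R : realType) (n : nat) (j : dyadic_index n)
  : set 'rV[R]_n :=
  cube (\row_i (dyadic_length R j * (j.2 0 i)%:~R)) (dyadic_length R j).

Definition dyadic_content (R : realType) (n : nat) (delta : R)
    (E : set 'rV[R]_n) : \bar R :=
  ereal_inf [set (\esum_(j in D) (dyadic_length R j `^ delta)%:E)%E
            | D in [set D : set (dyadic_index n) |
                     E `<=` interior (\bigcup_(j in D) @dyadic_cube R n j)]].

(* Only meaningful for f nonnegative on E, the only case in which it is used. *)
Definition choquet (R : realType) (n : nat) (delta : R)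
    (E : set 'rV[R]_n) (f : 'rV[R]_n -> R) : \bar R :=
  (\int[lebesgue_measure]_(t in `[0%R, +oo[)
     dyadic_content delta (E `&` [set x | (t < f x)%R]))%E.

Definition L1loc (R : realType) (n : nat) (delta : R)
    (f : 'rV[R]_n -> R) : Prop :=
  forall K : set 'rV[R]_n, compact K ->
    (choquet delta K (fun x => `|f x|%R) < +oo)%E.

Definition Epos (R : realType) (n : nat) (f : 'rV[R]_n -> R)
  : set 'rV[R]_n := [set x | 0 <= f x].

Definition Eneg (R : realType) (n : nat) (f : 'rV[R]_n -> R)
  : set 'rV[R]_n := [set x | f x < 0].

(* Computed in \bar R; for Q a cube, 0 < delta <= n and f in L1loc all four
   terms are finite and the denominator is positive. *)
Definition mean (R : realType) (n : nat) (delta : R) (f : 'rV[R]_n -> R)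
    (Q : set 'rV[R]_n) : \bar R :=
  ((choquet delta (Q `&` Epos f) f
    - choquet delta (Q `&` Eneg f) (fun x => (- f x)%R))
   / (dyadic_content delta (Q `&` Epos f)
      + dyadic_content delta (Q `&` Eneg f)))%E.

(* Main.v *)
(* Write P, N for the parts of Q where f >= 0, f < 0, and m for the mean.  The
   tangent line e^y >= e^m (1 - m) + e^m y bounds e^f below by c + k f on P and
   by c - k (-f) on N, with k = e^m > 0 and c = e^m (1 - m).  The Choquet
   integral is not additive, but it respects such affine bounds: integrating
   distribution functions gives at least c H(P) + k int_P f on P, and, by
   subadditivity of the content H, at least c H(N) - k int_N (-f) on N.  The sum
   is (H(P) + H(N)) e^m >= H(Q) e^m.  The second inequality is the first one for
   -f with P and N exchanged.  Finally H(Q) > 0, since small dyadic cubes satisfy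
   l^delta >= l^n and the volumes of cubes covering Q add up to at least that
   of Q. *)

Require Import Defs.
From HB Require Import structures.
From mathcomp Require Import all_boot all_order all_algebra.
From mathcomp Require Import all_classical all_reals all_analysis.
From mathcomp Require Import measurable_realfun ring lra.

Set Implicit Arguments.
Unset Strict Implicit.
Unset Printing Implicit Defensive.

Import Order.TTheory GRing.Theory Num.Theory.
Import numFieldNormedType.Exports.

Local Open Scope classical_set_scope.
Local Open Scope ring_scope.

(** * Volumes of cubes covering a cube *)

(* Both sides are integrated against one coordinate at a time. *)
Lemma box_cover_volume (R : realType) (b : nat -> R) (L : R)
    (a : nat -> nat -> R) (l : nat -> R) (p : nat) (c0 : R) (c : nat -> R) :
  0 <= L -> (forall j, 0 <= l j) -> 0 <= c0 -> (forall j, 0 <= c j) ->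
  (forall x : nat -> R,
    ((c0 * \prod_(i < p) \1_`]b i, b i + L] (x i))%:E <=
     \sum_(j <oo) (c j * \prod_(i < p) \1_`]a j i, a j i + l j] (x i))%:E)%E) ->
  ((c0 * L ^+ p)%:E <= \sum_(j <oo) (c j * l j ^+ p)%:E)%E.
Proof.
(* The coefficients stay general in the induction: integrating out coordinate [p] multiplies [c0] by
   [L] and [c j] by [l j]. *)
move=> L0 l0; elim: p c0 c => [|p IH] c0 c c00 cj0 H.
  have := H (fun=> 0); rewrite big_ord0 expr0.
  by under eq_eseriesr do rewrite big_ord0.
rewrite exprS mulrA.
under eq_eseriesr do rewrite exprS mulrA.
apply: IH => [||x].
- exact: mulr_ge0.
- by move=> j; exact: mulr_ge0.
have I1 (u v : R) : 0 <= v ->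
    (\int[lebesgue_measure]_t (\1_`]u, u + v] t : R)%:E = v%:E)%E.
  move=> v0; rewrite integral_indic//= setIT lebesgue_measure_itv/= lte_fin.
  rewrite ltrDl; case: ltP => [_|v0']; first by rewrite -EFinB addrAC subrr add0r.
  by congr EFin; apply/eqP; rewrite eq_le v0' v0.
have I2 (k u v : R) : 0 <= k -> 0 <= v ->
    (\int[lebesgue_measure]_t (k * \1_`]u, u + v] t)%:E = (k * v)%:E)%E.
  move=> k0 v0; under eq_integral do rewrite EFinM.
  rewrite ge0_integralZl_EFin//; first by rewrite I1.
    exact/measurable_EFinP/measurable_indic.
pose B q (w : nat -> R) (v : R) : R :=
  \prod_(i < q) \1_`]w i, w i + v] (x i).
have B0 q w v : 0 <= B q w v by rewrite prodr_ge0.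
have -> : c0 * L * B p b L = (c0 * B p b L) * L by ring.
rewrite -(I2 _ (b p))//; last exact: mulr_ge0.
have -> : (\sum_(j <oo) (c j * l j * B p (a j) (l j))%:E =
   \sum_(j <oo) \int[lebesgue_measure]_t
     ((c j * B p (a j) (l j)) * \1_`]a j p, a j p + l j] t)%:E)%E.
  apply: eq_eseriesr => j _; rewrite I2//; last exact: mulr_ge0.
  by congr EFin; ring.
have mI (k u v : R) : measurable_fun setT (fun t : R => (k * \1_`]u, u + v] t)%:E).
  by apply/measurable_EFinP; apply: measurable_funM => //; exact: measurable_indic.
rewrite -integral_nneseries//; first last.
- by move=> j t _; rewrite lee_fin !mulr_ge0.
- by move=> j; exact: mI.
apply: ge0_le_integral => //.
- by move=> t _; rewrite lee_fin !mulr_ge0.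
- exact: mI.
- apply: (ge0_emeasurable_sum (P := xpredT)) => [j t _ _|j _].
    by rewrite lee_fin !mulr_ge0.
  exact: mI.
(* The hypothesis is used at the point [x] with coordinate [p] replaced by the integration variable
   [t]. *)
move=> t _; have := H (fun i => if i == p then t else x i).
have E (w : nat -> R) v : \prod_(i < p.+1) (\1_`]w i, w i + v]%classic
    (if (i : nat) == p then t else x i) : R) = B p w v * \1_`]w p, w p + v] t.
  rewrite big_ord_recr/= eqxx; congr (_ * _).
  by apply: eq_bigr => i _; rewrite ltn_eqF.
rewrite E mulrA; under eq_eseriesr do rewrite E mulrA.
by [].
Qed.

(** A cover bounds the indicator of the cube by the sum of the indicators of the covering cubes, and
    [box_cover_volume] integrates this bound. The family is turned into a sequence through [pickle],
    with coefficient 0 at codes that do not come from [D]. *)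
Lemma cube_cover_volume (R : realType) (n : nat) (J : countType) (D : set J)
    (b : 'rV[R]_n) (L : R) (a : J -> 'rV[R]_n) (l : J -> R) :
  0 <= L -> (forall j, 0 <= l j) ->
  cube b L `<=` \bigcup_(j in D) cube (a j) (l j) ->
  ((L ^+ n)%:E <= \esum_(j in D) (l j ^+ n)%:E)%E.
Proof.
move=> L0 l0 cov.
pose ext (v : 'rV[R]_n) (i : nat) := oapp (v 0) 0 (insub i).
have extE v (i : 'I_n) : ext v i = v 0 i by rewrite /ext valK.
pose c (k : nat) : R := if @pickle_inv J k is Some j then (j \in D)%:R else 0.
pose l' (k : nat) := oapp l 0 (@pickle_inv J k).
pose a' (k : nat) := ext (oapp a 0 (@pickle_inv J k)).
have c0 k : 0 <= c k by rewrite /c; case: pickle_inv.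
have l'0 k : 0 <= l' k by rewrite /l'; case: pickle_inv => /=.
have boxE (v : 'rV[R]_n) (r : R) (x : nat -> R) :
    \prod_(i < n) (\1_`]ext v i, ext v i + r]%classic (x i) : R)
    = \1_(cube v r) (\row_i x i).
  rewrite indicE; case: (pselect (cube v r (\row_i x i))) => [h|h].
    rewrite mem_set// big1// => i _; rewrite indicE mem_set//= in_itv/= extE.
    by have := h i; rewrite mxE.
  rewrite memNset//; move/existsNP : h => [i hi].
  rewrite (bigD1 i)//= indicE memNset ?mul0r//= in_itv/= extE.
  by move: hi; rewrite mxE.
have /= := @box_cover_volume R (ext b) L a' l' n 1 c L0 l'0 ler01 c0.
rewrite mul1r => /(_ _)/le_trans; apply.
  move=> x; rewrite mul1r boxE.
  have t0 k : (0 <= (c k * \prod_(i < n)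
      \1_`]a' k i, a' k i + l' k]%classic (x i))%:E)%E.
    by rewrite lee_fin mulr_ge0// prodr_ge0.
  rewrite indicE; case: (pselect (cube b L (\row_i x i))) => [/cov|h]; last first.
    by rewrite memNset// nneseries_ge0.
  (* The partial sum over k < [(pickle j).+1] ends with the term of a cube containing the point; the
     other terms are nonnegative. *)
  case=> j Dj xj; apply: le_trans (nneseries_lim_ge (pickle j).+1 _) => //.
  rewrite big_mkord big_ord_recr/=.
  apply: le_trans (leeDr _ _); last by apply: sume_ge0 => ? _; exact: t0.
  rewrite /c /l' /a' pickleK_inv/= boxE indicE.
  by rewrite (mem_set Dj) (mem_set xj) lee_fin mulr1; case: (_ \in _).
rewrite nneseries_esumT; last by move=> k; rewrite lee_fin mulr_ge0// exprn_ge0.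
have -> : (\esum_(j in D) (l j ^+ n)%:E =
    \esum_(k in pickle @` D) (c k * l' k ^+ n)%:E)%E.
  rewrite esum_image; last by move=> i j _ _; exact: (pcan_inj (@pickleK_inv J)).
  by apply: eq_esum => j Dj; rewrite /c /l' pickleK_inv/= mem_set// mul1r.
rewrite [leRHS]esum_mkcond; apply: le_esum => k _; case: ifPn => // kD.
rewrite lee_fin /c /l'; case E: (@pickle_inv J k) => [j|]; last by rewrite mul0r.
case: (boolP (j \in D)) => [jD|]; last by rewrite mul0r.
case/negP: kD; apply/mem_set; exists j; first exact/set_mem.
by have := @pickle_invK J k; rewrite E.
Qed.

(** * Dyadic content: monotonicity, subadditivity, finiteness and positivity *)

Lemma dyadic_content_ge0 (R : realType) n (delta : R) (E : set 'rV[R]_n) :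
  (0 <= dyadic_content delta E)%E.
Proof.
apply: le_ereal_inf_tmp => _ [D _ <-]; apply: esum_ge0 => j _.
by rewrite lee_fin powR_ge0.
Qed.

Lemma le_dyadic_content (R : realType) n (delta : R) (E F : set 'rV[R]_n) :
  E `<=` F -> (dyadic_content delta E <= dyadic_content delta F)%E.
Proof.
move=> EF; apply: ereal_inf_le_tmp => _ [D FD <-]; exists D => //.
exact: subset_trans EF FD.
Qed.

Lemma le_esumU (R : realType) (T : choiceType) (A B : set T) (u : T -> \bar R) :
  (forall i, 0 <= u i)%E ->
  (\esum_(i in A `|` B) u i <= \esum_(i in A) u i + \esum_(i in B) u i)%E.
Proof.
move=> u0; rewrite esum_mkcond (esum_mkcond A) (esum_mkcond B).
rewrite -esumD; [|by move=> i _; case: ifP..].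
apply: le_esum => i _; rewrite in_setU.
by case: (i \in A); case: (i \in B); rewrite /= ?adde0 ?add0e ?leeDl.
Qed.

(** Two covers, each optimal up to e/2, are merged; the interior of the union contains both
    interiors. *)
Lemma dyadic_contentU (R : realType) n (delta : R) (E F : set 'rV[R]_n) :
  (dyadic_content delta (E `|` F) <=
   dyadic_content delta E + dyadic_content delta F)%E.
Proof.
have [->|Efin] := eqVneq (dyadic_content delta E) +oo%E.
  by rewrite addye ?leey// gt_eqF// (lt_le_trans _ (dyadic_content_ge0 _ _))// ltNy0.
have [->|Ffin] := eqVneq (dyadic_content delta F) +oo%E.
  by rewrite addey ?leey// gt_eqF// (lt_le_trans _ (dyadic_content_ge0 _ _))// ltNy0.
have fE : dyadic_content delta E \is a fin_num.
  by rewrite ge0_fin_numE ?dyadic_content_ge0// ltey.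
have fF : dyadic_content delta F \is a fin_num.
  by rewrite ge0_fin_numE ?dyadic_content_ge0// ltey.
apply/lee_addgt0Pr => e e0.
have e2 : 0 < e / 2 by rewrite divr_gt0.
have [_ [D ED <-] hD] := lb_ereal_inf_adherent e2 fE.
have [_ [D' FD <-] hD'] := lb_ereal_inf_adherent e2 fF.
rewrite (splitr e) EFinD addeACA.
apply: le_trans (leeD (ltW hD) (ltW hD')).
apply: le_trans (le_esumU _ _ _); last by move=> j; rewrite lee_fin powR_ge0.
apply: ereal_inf_lbound; exists (D `|` D') => //=.
rewrite bigcup_setU => x [/ED|/FD]; apply: interiorS; [exact: subsetUl|exact: subsetUr].
Qed.

Lemma dyadic_length_gt0 (R : realType) n (j : dyadic_index n) :
  0 < dyadic_length R j.
Proof. by rewrite exprz_gt0. Qed.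

Lemma dyadic_content_ball_lty (R : realType) n (delta : R) (r : R) :
  (dyadic_content delta (ball (0%R : 'rV[R]_n) r) < +oo)%E.
Proof.
have [N rN] : exists N : nat, r <= 2 ^+ N.
  exists (Num.bound `|r|); apply/ltW; apply: lt_trans (_ : r < (Num.bound `|r|)%:R) _.
    by rewrite (le_lt_trans (ler_norm _))// archi_boundP.
  by rewrite -natrX ltr_nat ltn_expl.
(* Dyadic cubes do not cross coordinate hyperplanes, so one cube of edge 2^N is taken in each
   orthant. As cubes are right-closed, a zero coordinate belongs to the side (-2^N, 0], hence the
   test [x 0 i <= 0] below. *)
pose corner (s : 'rV[bool]_n) : dyadic_index n :=
  (- (N%:Z), \row_i (if s 0 i then -1 else 0)).
have lenE s : dyadic_length R (corner s) = 2 ^+ N.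
  by rewrite /dyadic_length /= opprK.
apply: (@le_lt_trans _ _
  (\esum_(j in range corner) (dyadic_length R j `^ delta)%:E)%E).
  apply: ereal_inf_lbound; exists (range corner) => //=.
  rewrite -open_subsetE; last exact: ball_open.
  move=> x [r0 /(_ 0) xr]; exists (corner (\row_i (x 0 i <= 0))).
    by exists (\row_i (x 0 i <= 0)).
  move=> i; rewrite lenE !mxE/=.
  have := xr i; rewrite -ball_normE /= mxE sub0r normrN ltr_norml => /andP[h1 h2].
  by case: (leP (x 0 i) 0) => h; nra.
have fr : finite_set (range corner) by apply: finite_image; exact: finite_finset.
rewrite esum_fset//; last by move=> j _; rewrite lee_fin powR_ge0.
by rewrite fsbig_finite//= sumEFin ltry.
Qed.

Lemma dyadic_content_cube_gt0 (R : realType) n (delta : R) (Q : set 'rV[R]_n) :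
  0 < delta -> delta <= n%:R -> is_cube Q -> (0 < dyadic_content delta Q)%E.
Proof.
move=> d0 dn [a [L [L0 ->]]].
(* The value 1 serves covers having a cube of edge at least 1, and L^n serves all others. *)
apply: (@lt_le_trans _ _ (Num.min 1 (L ^+ n))%:E).
  by rewrite lte_fin lt_min ltr01 exprn_gt0.
apply: le_ereal_inf_tmp => _ [D covD <-].
have {}covD := subset_trans covD (@interior_subset _ _).
have [[j Dj j1]|small] := pselect (exists2 j, D j & 1 <= dyadic_length R j).
  apply: (@le_trans _ _ (dyadic_length R j `^ delta)%:E).
    rewrite lee_fin; apply: (@le_trans _ _ 1); first by rewrite ge_min lexx.
    by rewrite -(powRr0 (dyadic_length R j)) ler_powR// ltW.
  apply: esum_ge; exists [set j]; last by rewrite fsbig_set1.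
  by split=> // i ->.
apply: (@le_trans _ _ (L ^+ n)%:E); first by rewrite lee_fin ge_min lexx orbT.
apply: le_trans (cube_cover_volume (ltW L0) _ covD) _.
  by move=> j; apply/ltW/dyadic_length_gt0.
apply: le_esum => j Dj; rewrite lee_fin -powR_mulrn; last exact/ltW/dyadic_length_gt0.
have l1 : dyadic_length R j < 1.
  by rewrite ltNge; apply/negP => j1; apply: small; exists j.
by apply: ger_powR => //; rewrite dyadic_length_gt0 ltW.
Qed.

Lemma compact_sub_ball (R : realType) n (K : set 'rV[R]_n) :
  compact K -> exists r : R, K `<=` ball 0 r.
Proof.
(* Norms on K are at most any number above M; the choice M + 1 leaves room for the strict inequality
   of the ball of radius M + 2. *)
move=> /compact_bounded[M [_ KM]]; exists (M + 2) => x Kx.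
rewrite -ball_normE /= sub0r normrN; apply: le_lt_trans (KM (M + 1) _ _ Kx) _; lra.
Qed.

Lemma cube_sub_compact (R : realType) n (Q : set 'rV[R]_n) :
  is_cube Q -> exists2 K, compact K & Q `<=` K.
Proof.
move=> [a [l [_ ->]]].
exists [set v : 'rV[R]_n | forall i, `[a 0 i, a 0 i + l]%classic (v 0 i)].
  apply: (@rV_compact R n (fun i => `[a 0 i, a 0 i + l]%classic)) => i.
  exact: segment_compact.
by move=> x xQ i; rewrite /= in_itv/=; have /andP[/ltW-> ->] := xQ i.
Qed.

Lemma dyadic_content_bounded_fin_num (R : realType) n (delta r : R)
    (E : set 'rV[R]_n) :
  E `<=` ball 0 r -> dyadic_content delta E \is a fin_num.
Proof.
move=> Er; rewrite ge0_fin_numE ?dyadic_content_ge0//.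
exact: le_lt_trans (le_dyadic_content _ Er) (dyadic_content_ball_lty _ _ _).
Qed.

(** * Affine substitution in Lebesgue integrals *)

Section lebesgue_affine.
Variable R : realType.
Local Notation mu := (@lebesgue_measure R).

Let affine (c k : R) : measurableTypeR R -> measurableTypeR R := fun s => c + k * s.

Let measurable_affine (c k : R) : measurable_fun setT (affine c k).
Proof. by apply: measurable_funD => //; apply: measurable_funM. Qed.

Let image (c k : R) : {measure set (measurableTypeR R) -> \bar R}.
Proof.
refine (pushforward mu (affine c k)); exact: measurable_affine.
Defined.

(** By uniqueness of Lebesgue measure it suffices that |k| times the pushforward gives half-open
    intervals their length. *)
Lemma lebesgue_measure_affine (c k : R) (A : set R) : k != 0 -> measurable A ->
  mu A = (`|k|%:E * mu [set s | A (c + k * s)%R])%E.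
Proof.
move=> k0; apply: (lebesgue_measure_unique (mu := mscale (`|k|%:nng) (image c k))).
move=> _ [[a b] _ <-]; rewrite /= /mscale /= /pushforward.
have [k_gt0|k_lt0] := ltrP 0 k.
  have -> : affine c k @^-1` `]a, b] = `](a - c) / k, (b - c) / k]%classic.
    apply/seteqP; split=> s /=; rewrite !in_itv/= /affine;
      by rewrite ltr_pdivrMr// ler_pdivlMr// ltrBlDl lerBrDl mulrC.
  rewrite !lebesgue_measure_itv/= !lte_fin ltr_pM2r ?invr_gt0// ltrD2r.
  case: ifPn => _; last by rewrite mule0.
  by rewrite -!EFinB -EFinM gtr0_norm//; congr EFin; field.
have {}k_lt0 : k < 0 by rewrite lt_neqAle k0.
(* A negative slope swaps the endpoints, so the preimage is closed on the left and open on the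
   right. *)
have -> : affine c k @^-1` `]a, b] = `[(b - c) / k, (a - c) / k[%classic.
  apply/seteqP; split=> s /=; rewrite !in_itv/= /affine;
    by rewrite ltr_ndivlMr// ler_ndivrMr// ltrBlDl lerBrDl andbC mulrC.
rewrite !lebesgue_measure_itv/= !lte_fin ltr_nM2r ?invr_lt0// ltrD2r.
case: ifPn => _; last by rewrite mule0.
by rewrite -!EFinB -EFinM ltr0_norm//; congr EFin; field.
Qed.

Lemma ge0_integral_affine (c k : R) (D : set R) (G : R -> \bar R) :
  k != 0 -> measurable D -> measurable_fun D G -> (forall t, D t -> 0 <= G t)%E ->
  (\int[mu]_(t in D) G t =
   `|k|%:E * \int[mu]_(s in [set s | D (c + k * s)%R]) G (c + k * s)%R)%E.
Proof.
move=> k0 mD mG G0.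
transitivity (\int[mscale (`|k|%:nng)%R (image c k)]_(t in D) G t)%E.
  by apply: eq_measure_integral => A mA _; exact: lebesgue_measure_affine.
rewrite ge0_integral_mscale// (ge0_integral_pushforward (measurable_affine c k))//.
by move=> t; rewrite inE; exact: G0.
Qed.
End lebesgue_affine.

(** * Integrals of distribution functions under affine bounds *)

Section tails.
Variable R : realType.
Local Notation mu := (@lebesgue_measure R).
Variables (phi psi : R -> \bar R) (M c k : R).
Hypotheses (k_gt0 : 0 < k).
Hypotheses (mphi : measurable_fun setT phi) (mpsi : measurable_fun setT psi).
Hypotheses (phi_ge0 : forall t, (0 <= phi t)%E) (psi_ge0 : forall t, (0 <= psi t)%E).

(** In the application [phi] and [psi] are the distribution functions of g and of F >= c + k g on a
    set of content [M]. The substitution t = c + k s turns the right side into k times the integral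
    of psi(c + k s) over s >= -c/k, to be compared with that of [phi] over s >= 0. *)
Lemma ge0_integral_tail_affine :
  (forall s, (phi s <= M%:E)%E) ->
  (forall s, s < 0 -> (M%:E <= psi (c + k * s)%R)%E) ->
  (forall s, 0 <= s -> (phi s <= psi (c + k * s)%R)%E) ->
  ((c * M)%:E + k%:E * \int[mu]_(s in `[0%R, +oo[) phi s
    <= \int[mu]_(t in `[0%R, +oo[) psi t)%E.
Proof.
move=> phiM Mpsi phipsi.
have mpsi' D : measurable_fun D (fun s => psi (c + k * s)%R).
  apply: measurable_funTS; apply: measurableT_comp => //.
  by apply: measurable_funD => //; exact: measurable_funM.
have M_ge0 : 0 <= M by rewrite -lee_fin (le_trans (phi_ge0 0)).
rewrite (@ge0_integral_affine R c k _ psi)//; first last.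
- exact: measurable_funTS.
- by rewrite gt_eqF.
have -> : [set s | `[0, +oo[%classic (c + k * s)] = `[- c / k, +oo[%classic.
  apply/seteqP; split=> s /=; rewrite !in_itv/= !andbT ler_pdivrMr// => h; lra.
rewrite gtr0_norm//.
(* For c >= 0 the range also contains [-c/k, 0), where psi(c + k s) >= M; this stretch of length c/k
   supplies the term c M. *)
have [c0|c0] := leP 0 c.
  have ck : - c / k <= 0 by rewrite pmulr_lle0 ?invr_gt0// oppr_le0.
  rewrite (@itv_bndbnd_setU _ _ (BLeft (- c / k)) (BLeft 0) (BInfty _ false))//.
  rewrite ge0_integral_setU//=; first last.
  - apply/disj_setPS => s [] /=; rewrite !in_itv/= andbT => /andP[_ s0] s0'; lra.
  - exact: mpsi'.
    rewrite [leRHS]ge0_muleDr ?integral_ge0//. apply: leeD.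
    have -> : (c * M)%:E = (k%:E * \int[mu]_(s in `[(- c / k)%R, 0%R[) M%:E)%E.
      rewrite integral_cst//= lebesgue_measure_itv/= lte_fin.
      have [ck0|ck0] := ltP (- c / k) 0.
        by rewrite -EFinD -!EFinM; congr EFin; field; rewrite gt_eqF.
      rewrite !mule0; congr EFin.
      have -> : c = 0 by move: ck0; rewrite pmulr_lge0 ?invr_gt0//; lra.
      exact: mul0r.
    rewrite lee_pmul2l//; apply: ge0_le_integral => //; first exact: mpsi'.
    by move=> s /=; rewrite in_itv/= => /andP[_ s0]; exact: Mpsi.
  rewrite lee_pmul2l//; apply: ge0_le_integral => //; [exact: measurable_funTS|exact: mpsi'|].
  by move=> s /=; rewrite in_itv/= andbT; exact: phipsi.
(* For c < 0 the range misses [0, -c/k), where phi <= M; the loss is at most -c M, which the term c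
   M compensates. *)
have ck : 0 < - c / k by rewrite divr_gt0// oppr_gt0.
rewrite (@itv_bndbnd_setU _ _ (BLeft 0) (BLeft (- c / k)) (BInfty _ false))//; last first.
  by rewrite bnd_simp ltW.
rewrite ge0_integral_setU//=; first last.
- apply/disj_setPS => s [] /=; rewrite !in_itv/= andbT => /andP[_ s0] s0'; lra.
- exact: measurable_funTS.
rewrite [X in (_ + X <= _)%E]ge0_muleDr ?integral_ge0//.
have h1 : (k%:E * \int[mu]_(s in `[0%R, (- c / k)%R[) phi s <= (- (c * M))%:E)%E.
  have -> : (- (c * M))%:E = (k%:E * \int[mu]_(s in `[0%R, (- c / k)%R[) M%:E)%E.
    rewrite integral_cst//= lebesgue_measure_itv/= lte_fin ck.
    by rewrite -EFinD -!EFinM; congr EFin; field; rewrite gt_eqF.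
  by rewrite lee_pmul2l//; apply: ge0_le_integral => //; exact: measurable_funTS.
have h2 : (k%:E * \int[mu]_(s in `[(- c / k)%R, +oo[) phi s <=
           k%:E * \int[mu]_(s in `[(- c / k)%R, +oo[) psi (c + k * s)%R)%E.
  rewrite lee_pmul2l//; apply: ge0_le_integral => //; [exact: measurable_funTS|exact: mpsi'|].
  by move=> s /=; rewrite in_itv/= andbT => /(le_trans (ltW ck)); exact: phipsi.
apply: le_trans (leeD2l _ (leeD h1 h2)) _.
by rewrite addeA -EFinD subrr add0e.
Qed.

(** For c > 0 the map s -> c - k s carries [0, c/k] onto [0, c]. Truncating both integrals to these
    intervals puts them over the same s, where the sum of the integrands is at least [M]. For c <= 0
    the left side is nonpositive. *)
Lemma ge0_integral_tail_affineN : 0 <= M ->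
  (forall s, 0 <= s -> (M%:E <= psi (c - k * s)%R + phi s)%E) ->
  ((c * M)%:E <= \int[mu]_(t in `[0%R, +oo[) psi t
     + k%:E * \int[mu]_(s in `[0%R, +oo[) phi s)%E.
Proof.
move=> M0 H.
have [c0|c0] := leP c 0.
  apply: (@le_trans _ _ 0%E); first by rewrite lee_fin mulr_le0_ge0.
  by rewrite adde_ge0 ?mule_ge0 ?integral_ge0 ?lee_fin// ltW.
have mpsi' D : measurable_fun D (fun s => psi (c + - k * s)%R).
  apply: measurable_funTS; apply: measurableT_comp => //.
  by apply: measurable_funD => //; exact: measurable_funM.
apply: (@le_trans _ _ (\int[mu]_(t in `[0%R, c]) psi t
  + k%:E * \int[mu]_(s in `[0%R, (c / k)%R]) phi s)%E); last first.
  apply: leeD.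
    apply: ge0_subset_integral => //; first exact: measurable_funTS.
    by move=> s /=; rewrite !in_itv/= andbT => /andP[].
  rewrite lee_pmul2l//; apply: ge0_subset_integral => //; first exact: measurable_funTS.
  by move=> s /=; rewrite !in_itv/= andbT => /andP[].
rewrite (@ge0_integral_affine R c (- k))//; first last.
- exact: measurable_funTS.
- by rewrite oppr_eq0 gt_eqF.
have -> : [set s | `[0, c]%classic (c + - k * s)] = `[0, c / k]%classic.
  apply/seteqP; split=> s /=; rewrite !in_itv/= ler_pdivlMr//;
    by rewrite mulNr gerDl oppr_le0 pmulr_rge0// subr_ge0 andbC mulrC.
rewrite normrN gtr0_norm// -ge0_muleDr ?integral_ge0// -ge0_integralD//; first last.
- exact: measurable_funTS.
- exact: mpsi'.
have -> : (c * M)%:E = (k%:E * \int[mu]_(s in `[0%R, (c / k)%R]) M%:E)%E.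
  rewrite integral_cst//= lebesgue_measure_itv/= lte_fin divr_gt0//.
  by rewrite -EFinD -!EFinM; congr EFin; field; rewrite gt_eqF.
rewrite lee_pmul2l//; apply: ge0_le_integral => //.
  by apply: emeasurable_funD; [exact: mpsi'|exact: measurable_funTS].
by move=> s /=; rewrite in_itv/= => /andP[s0 _]; rewrite mulNr; exact: H.
Qed.

End tails.

(** * Affine bounds and Jensen's inequality for the Choquet integral *)

Section choquet.
Variables (R : realType) (n : nat) (delta : R).
Local Notation H := (@dyadic_content R n delta).
Implicit Types (E P N : set 'rV[R]_n) (f g u v F : 'rV[R]_n -> R).

(** Superlevel sets shrink as t grows, so the tail is monotone and hence measurable, whatever g
    is. *)
Lemma measurable_dyadic_content_tail E g : H E \is a fin_num ->
  measurable_fun setT (fun t : R => H (E `&` [set x | t < g x])).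
Proof.
move=> HE.
have fin t : H (E `&` [set x | t < g x]) \is a fin_num.
  rewrite ge0_fin_numE ?dyadic_content_ge0//.
  apply: le_lt_trans (le_dyadic_content _ (@subIsetl _ _ _)) _.
  by rewrite ltey_eq HE.
rewrite (_ : (fun t => _) = EFin \o (fun t => fine (H (E `&` [set x | t < g x])))).
  apply/measurable_EFinP; apply: nonincreasing_measurable => // s t st.
  rewrite fine_le//; apply: le_dyadic_content => x [Ex tx]; split=> //.
  exact: le_lt_trans tx.
by apply/funext => t /=; rewrite fineK.
Qed.

Lemma choquet_ge0 E g : (0 <= choquet delta E g)%E.
Proof. by apply: integral_ge0 => t _; exact: dyadic_content_ge0. Qed.

Lemma le_choquet E E' g g' : H E' \is a fin_num -> E `<=` E' ->
  (forall x, E x -> g x <= g' x) -> (choquet delta E g <= choquet delta E' g')%E.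
Proof.
move=> HE' EE' gg'.
have HE : H E \is a fin_num.
  rewrite ge0_fin_numE ?dyadic_content_ge0//.
  by apply: le_lt_trans (le_dyadic_content _ EE') _; rewrite ltey_eq HE'.
apply: ge0_le_integral => //.
- by move=> t _; exact: dyadic_content_ge0.
- by apply: measurable_funTS; exact: measurable_dyadic_content_tail.
- by apply: measurable_funTS; exact: measurable_dyadic_content_tail.
move=> t _; apply: le_dyadic_content => x [Ex tx]; split; first exact: EE'.
exact: lt_le_trans tx (gg' _ Ex).
Qed.

(** On E, g > s forces F > c + k s; for s < 0 this covers all of E because g >= 0. *)
Lemma choquet_ge_affine E g F (c k : R) : H E \is a fin_num -> 0 < k ->
  (forall x, E x -> 0 <= g x) -> (forall x, E x -> c + k * g x <= F x) ->
  ((c * fine (H E))%:E + k%:E * choquet delta E g <= choquet delta E F)%E.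
Proof.
move=> HE k0 g0 gF; apply: ge0_integral_tail_affine => //.
- exact: measurable_dyadic_content_tail.
- exact: measurable_dyadic_content_tail.
- by move=> t; exact: dyadic_content_ge0.
- by move=> t; exact: dyadic_content_ge0.
- by move=> s; rewrite fineK//; apply: le_dyadic_content; exact: subIsetl.
- move=> s s0; rewrite fineK//; apply: le_dyadic_content => x Ex; split=> //=.
  by apply: lt_le_trans (gF _ Ex); rewrite ltrD2l ltr_pM2l// (lt_le_trans s0)// g0.
- move=> s s0; apply: le_dyadic_content => x [Ex /= sx]; split=> //=.
  by apply: lt_le_trans (gF _ Ex); rewrite ltrD2l ltr_pM2l.
Qed.

(** Each point of E has g > s or, up to an arbitrarily small loss in c, F > c - k s; subadditivity
    then bounds H(E) by the two tails. The sum form avoids subtracting a possibly infinite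
    integral. *)
Lemma choquet_ge_affineN E g F (c k : R) : H E \is a fin_num -> 0 < k ->
  (forall x, E x -> c - k * g x <= F x) ->
  ((c * fine (H E))%:E <= choquet delta E F + k%:E * choquet delta E g)%E.
Proof.
move=> HE k0 gF; apply/lee_addgt0Pr => e e0.
(* Lowering c to c - d makes the bound strict, so that E is covered by the strict
   superlevel sets {F > c - d - k s} and {g > s} for every s >= 0. *)
have h0 : 0 <= fine (H E) by rewrite fine_ge0// dyadic_content_ge0.
have h1 : 0 < fine (H E) + 1 by rewrite ltr_wpDl.
(* The added 1 keeps the denominator positive when H(E) = 0, and d H(E) <= e. *)
pose d := e / (fine (H E) + 1).
have d0 : 0 < d by rewrite divr_gt0.
have -> : (c * fine (H E))%:E = (((c - d) * fine (H E))%:E + (d * fine (H E))%:E)%E.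
  by rewrite -EFinD; congr EFin; ring.
apply: leeD; last first.
  rewrite lee_fin /d mulrAC -mulrA ler_piMr ?(ltW e0)// ler_pdivrMr// mul1r.
  by rewrite lerDl.
apply: ge0_integral_tail_affineN => //.
- exact: measurable_dyadic_content_tail.
- exact: measurable_dyadic_content_tail.
- by move=> t; exact: dyadic_content_ge0.
- by move=> t; exact: dyadic_content_ge0.
move=> s s0; rewrite fineK//; apply: le_trans (dyadic_contentU _ _ _).
apply: le_dyadic_content => x Ex; rewrite -setIUr; split=> //=.
have [gs|] := leP (g x) s; [left|by right].
apply: lt_le_trans (gF _ Ex); rewrite ltr_leD// ?lerN2 ?ler_pM2l//.
by rewrite ltrBlDr ltrDl.
Qed.

(** The two sets and functions are arbitrary so that both inequalities are instances: (f, -f) on (P,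
    N) and (-f, f) on (N, P). *)
Lemma choquet_jensen P N u v (h := fine (H P) + fine (H N))
    (m := (fine (choquet delta P u) - fine (choquet delta N v)) / h) :
  H P \is a fin_num -> H N \is a fin_num -> 0 < h ->
  choquet delta P u \is a fin_num -> choquet delta N v \is a fin_num ->
  (forall x, P x -> 0 <= u x) ->
  ((h * expR m)%:E <= choquet delta P (fun x => expR (u x))
                     + choquet delta N (fun x => expR (- v x)))%E.
Proof.
move=> HP HN h0 fu fv u0.
pose k := expR m; pose c := k * (1 - m).
have k0 : 0 < k := expR_gt0 _.
have tangent y : c + k * y <= expR y.
  have -> : expR y = k * expR (y - m) by rewrite -expRD addrC subrK.
  rewrite /c -mulrDr ler_pM2l//; apply: le_trans (expR_ge1Dx _); lra.
have hu := choquet_ge_affine HP k0 u0 (fun x _ => tangent (u x)).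
have hv : ((c * fine (H N))%:E <=
    choquet delta N (fun x => expR (- v x)) + k%:E * choquet delta N v)%E.
  by apply: choquet_ge_affineN => // x _; rewrite -mulrN.
have {}hv : ((c * fine (H N))%:E - k%:E * choquet delta N v <=
    choquet delta N (fun x => expR (- v x)))%E.
  by rewrite leeBlDr// fin_numM.
apply: le_trans (leeD hu hv).
rewrite -{1}(fineK fu) -{1}(fineK fv) -!EFinM -EFinB -!EFinD lee_fin le_eqVlt.
apply/orP; left; apply/eqP; rewrite /c -/k.
have hm : h * m = fine (choquet delta P u) - fine (choquet delta N v).
  by rewrite /m mulrC divfK// gt_eqF.
suff -> : k * (1 - m) * fine (H P) + k * fine (choquet delta P u)
  + (k * (1 - m) * fine (H N) - k * fine (choquet delta N v))
  = k * ((1 - m) * h + (fine (choquet delta P u) - fine (choquet delta N v))).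
  by rewrite -hm; ring.
by rewrite /h; ring.
Qed.

(** Replaces the weight H(P) + H(N) by the smaller H(Q). [X] is extended because integrals of
    exponentials may be infinite. *)
Lemma le_inve_mule (q h y : R) (X : \bar R) : 0 < q -> q <= h -> 0 <= y ->
  ((h * y)%:E <= X)%E -> (y%:E <= (q%:E)^-1 * X)%E.
Proof.
move=> q0 qh y0 hX; rewrite inver gt_eqF//.
apply: (@le_trans _ _ ((q^-1)%:E * (h * y)%:E)%E).
  by rewrite -EFinM lee_fin mulrA ler_peMl// mulrC ler_pdivlMr// mul1r.
by rewrite lee_pmul2l// lte_fin invr_gt0.
Qed.

End choquet.

(** * The two exponential inequalities on a cube *)

Theorem lemma2p2 (R : realType) (n : nat) (delta : R)
    (delta_gt0 : 0 < delta) (delta_le : delta <= n%:R)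
    (f : 'rV[R]_n -> R) (hf : L1loc delta f)
    (Q : set 'rV[R]_n) (hQ : is_cube Q) :
  (expeR (mean delta f Q) <=
     (dyadic_content delta Q)^-1 *
     (choquet delta (Q `&` Epos f) (fun x => expR (f x))
      + choquet delta (Q `&` Eneg f) (fun x => expR (f x))))%E
  /\
  (expeR (- mean delta f Q) <=
     (dyadic_content delta Q)^-1 *
     (choquet delta (Q `&` Epos f) (fun x => expR (- f x)%R)
      + choquet delta (Q `&` Eneg f) (fun x => expR (- f x)%R)))%E.
Proof.
have [K Kc QK] := cube_sub_compact hQ.
have [r Kr] := compact_sub_ball Kc.
have fin E : E `<=` K -> dyadic_content delta E \is a fin_num.
  by move=> EK; exact: dyadic_content_bounded_fin_num (subset_trans EK Kr).
have finC E g : E `<=` K -> (forall x, E x -> g x <= `|f x|) ->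
    choquet delta E g \is a fin_num.
  move=> EK gf; rewrite ge0_fin_numE ?choquet_ge0//.
  by apply: le_lt_trans (hf K Kc); apply: le_choquet => //; exact: fin.
set P := Q `&` Epos f; set N := Q `&` Eneg f.
have PK : P `<=` K by apply: subset_trans QK; exact: subIsetl.
have NK : N `<=` K by apply: subset_trans QK; exact: subIsetl.
have fP : choquet delta P f \is a fin_num by apply: finC => // x _; exact: ler_norm.
have fN : choquet delta N (fun x => - f x) \is a fin_num.
  by apply: finC => // x _; rewrite -normrN ler_norm.
set hP := fine (dyadic_content delta P); set hN := fine (dyadic_content delta N).
set q := fine (dyadic_content delta Q).
have q0 : 0 < q.
  by rewrite fine_gt0// dyadic_content_cube_gt0//= -ge0_fin_numE ?dyadic_content_ge0 ?fin.
have qh : q <= hP + hN.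
  rewrite -lee_fin EFinD !fineK ?fin//.
  apply: le_trans (dyadic_contentU _ _ _); apply: le_dyadic_content => x Qx.
  by case: (leP 0 (f x)) => h; [left|right].
have h0 : 0 < hP + hN := lt_le_trans q0 qh.
set a := fine (choquet delta P f); set b := fine (choquet delta N (fun x => - f x)).
(* All four terms are finite and the denominator is positive, so the mean is a real quotient. *)
have meanE : mean delta f Q = ((a - b) / (hP + hN))%:E.
  rewrite /mean -/P -/N -(fineK fP) -(fineK fN) -(fineK (fin _ PK)) -(fineK (fin _ NK)).
  by rewrite -EFinB -EFinD inver gt_eqF.
rewrite meanE -(fineK (fin _ QK)); split.
  apply: (@le_inve_mule _ _ (hP + hN)) => //.
  have := @choquet_jensen R n delta P N f (fun x => - f x) (fin _ PK) (fin _ NK) h0 fP fN.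
  have -> : (fun x => expR (- - f x)) = (fun x => expR (f x)).
    by apply/funext => x; rewrite opprK.
  by apply=> x [].
(* The negated mean is (b - a) / (hN + hP), the mean formed from -f on N and f on P. *)
rewrite -EFinN /= -mulNr opprB addeC.
rewrite addrC in qh h0 *.
apply: (@le_inve_mule _ _ (hN + hP)) => //.
apply: choquet_jensen => //; rewrite ?fin//.
by move=> x [_ /ltW]; rewrite oppr_ge0.
Qed.
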